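(* Let $\mathsf V$ be a pseudovariety of semigroups containing $\mathcal{L}\mathsf{Sl}$, and let $\mathcal X$ and $\mathcal Y$ be subshifts (over possibly different alphabets) such that $\mathbb K(\mathcal M_{\mathsf V}(\mathcal X))$ and $\mathbb K(\mathcal M_{\mathsf V}(\mathcal Y))$ are isomorphic compact categories. Then $\zeta_{\mathcal X}=\zeta_{\mathcal Y}$.
   Context: Alphabets are finite nonempty sets; $A^+$ is the free semigroup on $A$. A pseudovariety of semigroups is a class of finite semigroups closed under subsemigroups, homomorphic images and finite direct products. $\mathcal L\mathsf{Sl}$ is the class of finite semigroups $S$ such that $eSe$ is a semilattice (commutative, all elements idempotent) for every idempotent $e$ of $S$. $\widehat F_{\mathsf V}(A)$ is the free pro-$\mathsf V$ semigroup on $A$, i.e. the inverse limit of the finite quotients of $A^+$ belonging to $\mathsf V$; if $\mathsf V\supseteq\mathcal L\mathsf{Sl}$, $A^+$ embeds in it as a dense subsemigroup of isolated points. A subshift of $A^{\mathbb Z}$ is a nonempty closed set $\mathcal X\subseteq A^{\mathbb Z}$ with $\sigma(\mathcal X)=\mathcal X$, where $\sigma((x_i)_i)=(x_{i+1})_i$. $L(\mathcal X)\subseteq A^+$ is the set of nonempty finite words occurring in elements of $\mathcal X$. Let $p_{\mathcal X}(n)$ be the number of $x\in\mathcal X$ with $\sigma^n(x)=x$. The zeta function of $\mathcal X$ is $\zeta_{\mathcal X}(t)=\exp\bigl(\sum_{n=1}^{\infty}\frac{p_{\mathcal X}(n)}{n}t^n\bigr)$. The mirage $\mathcal M_{\mathsf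 V}(\mathcal X)$ is the set of $u\in\widehat F_{\mathsf V}(A)$ all of whose factors in $A^+$ belong to $L(\mathcal X)$. $\mathbb K(\mathcal M_{\mathsf V}(\mathcal X))$ is the category whose objects are the idempotents of $\widehat F_{\mathsf V}(A)$ belonging to $\mathcal M_{\mathsf V}(\mathcal X)$, whose arrows $f\to e$ are the triples $(e,u,f)$ with $u\in\mathcal M_{\mathsf V}(\mathcal X)$ and $u=euf$, with composition $(e,u,f)(f,v,g)=(e,uv,g)$ and identities $(e,e,e)$. With the topologies on objects and arrows induced from $\widehat F_{\mathsf V}(A)$ and $\widehat F_{\mathsf V}(A)^3$ it is a compact category (compact Hausdorff spaces of objects and arrows, with continuous domain, codomain, identity and composition maps). Isomorphisms of compact categories are isomorphisms of categories that are homeomorphisms on objects and on arrows. *)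

(* Defs.v *)
From HB Require Import structures.
From mathcomp Require Import all_boot all_order all_algebra.
From mathcomp Require Import finmap.
From mathcomp Require Import all_classical all_reals all_analysis.

Set Implicit Arguments.
Unset Strict Implicit.
Unset Printing Implicit Defensive.

Import Order.TTheory GRing.Theory Num.Theory.
Local Open Scope classical_set_scope.
Local Open Scope quotient_scope.

#[short(type="finSemigroupType")]
HB.structure Definition FinSemigroup := {S of Semigroup S & Finite S}.

Definition is_hom (S T : magmaType) (f : S -> T) : Prop :=
  {morph f : x y / (x * y)%g}.

Section DirectProduct.
Variables (I : finType) (S : I -> finSemigroupType).

Definition dprod_semigroup := {dffun forall i : I, S i}.

HB.instance Definition _ := Finite.on dprod_semigroup.

Definition dprod_mul (f g : dprod_semigroup) : dprod_semigroup :=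
  [ffun i => (f i * g i)%g].

Lemma dprod_mulA : associative dprod_mul.
Proof. by move=> f g h; apply/ffunP => i; rewrite !ffunE mulgA. Qed.

HB.instance Definition _ := isSemigroup.Build dprod_semigroup dprod_mulA.

End DirectProduct.

(* Semigroups are meant to be nonempty, whereas a finSemigroupType may be      *)
(* empty. Whether V holds of the empty semigroup is left open, and plays no    *)
(* role below.                                                                 *)
Record is_pseudovariety (V : finSemigroupType -> Prop) : Prop := {
  pv_sub : forall (S T : finSemigroupType) (f : S -> T),
    (0 < #|S|)%N -> is_hom f -> injective f -> V T -> V S;
  pv_img : forall (S T : finSemigroupType) (f : S -> T),
    is_hom f -> (forall y, exists x, f x = y) -> V S -> V T;
  pv_prod : forall (I : finType) (S : I -> finSemigroupType),
    (forall i, V (S i)) -> V (dprod_semigroup S)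
}.

Definition locally_semilattice (S : finSemigroupType) : Prop :=
  (0 < #|S|)%N /\
  forall e : S, (e * e = e)%g ->
    let eSe := [set x : S | exists s, x = (e * s * e)%g] in
    (forall x, eSe x -> (x * x = x)%g) /\
    (forall x y, eSe x -> eSe y -> (x * y = y * x)%g).

Section FreeSemigroup.
Variable A : finType.

Definition word := {w : seq A | w != [::]}.

HB.instance Definition _ := Choice.on word.

Lemma cat_neq_nil (u v : word) : val u ++ val v != [::].
Proof. by case: u => -[]. Qed.

Definition word_mul (u v : word) : word :=
  exist _ (val u ++ val v) (cat_neq_nil u v).

Lemma word_mulA : associative word_mul.
Proof. by move=> u v w; apply: val_inj; rewrite /= catA. Qed.

HB.instance Definition _ := isSemigroup.Build word word_mulA.

End FreeSemigroup.

Section FreeProfinite.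
Variables (V : finSemigroupType -> Prop) (A : finType).

(* Congruences r of A^+ such that A^+ / r is (isomorphic to) a member of V. *)
Record vcong := VCong {
  vrel :> rel (word A);
  vrelP : exists (S : finSemigroupType) (phi : word A -> S),
    [/\ V S, is_hom phi, (forall s, exists w, phi w = s)
      & forall u v, vrel u v = (phi u == phi v)]
}.

HB.instance Definition _ := gen_eqMixin vcong.
HB.instance Definition _ := gen_choiceMixin vcong.

Lemma vrel_equiv (r : vcong) : equiv_class_of r.
Proof.
have [S [phi [_ _ _ rE]]] := vrelP r.
by split=> [u|u v|v u w]; rewrite !rE // => /eqP->.
Qed.

Lemma vrel_mul (r : vcong) (u u' v v' : word A) :
  r u u' -> r v v' -> r (u * v)%g (u' * v')%g.
Proof.
have [S [phi [_ phiM _ rE]]] := vrelP r; rewrite !rE !phiM.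
by move=> /eqP-> /eqP->.
Qed.

Canonical vrel_equivRel (r : vcong) := EquivRelPack (vrel_equiv r).

Definition vquot (r : vcong) := {eq_quot r}.

HB.instance Definition _ r := Choice.on (vquot r).

Definition vpi (r : vcong) (w : word A) : vquot r := \pi_({eq_quot r}) w.

Definition vrepr (r : vcong) (x : vquot r) : word A := @repr _ {eq_quot r} x.

Lemma vreprK r : cancel (@vrepr r) (@vpi r).
Proof. by move=> x; rewrite /vpi reprK. Qed.

Lemma vpiP r u v : reflect (vpi r u = vpi r v) (r u v).
Proof. exact: eqmodP. Qed.

Definition vquot_mul (r : vcong) (x y : vquot r) : vquot r :=
  vpi r (vrepr x * vrepr y)%g.

Lemma vpiM r u v : vpi r (u * v)%g = vquot_mul (vpi r u) (vpi r v).
Proof. by apply/vpiP/vrel_mul; apply/vpiP; rewrite vreprK. Qed.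

Lemma vquot_mulA r : associative (@vquot_mul r).
Proof.
move=> x y z; rewrite -[x]vreprK -[y]vreprK -[z]vreprK -!vpiM.
by rewrite mulgA.
Qed.

HB.instance Definition _ r := isSemigroup.Build (vquot r) (@vquot_mulA r).

HB.instance Definition _ r :=
  Topological.copy (vquot r) (discrete_topology (vquot r)).

Definition vproj (r s : vcong) (x : vquot r) : vquot s := vpi s (vrepr x).

(* Inverse limit of the quotients A^+ / r along the projections               *)
(* A^+ / r -> A^+ / s for r included in s, as a subspace of the product of the *)
(* discrete spaces A^+ / r.                                                    *)
Definition coherent : set (prod_topology (fun r => vquot r : topologicalType)) :=
  [set u | forall r s : vcong, subrel r s -> vproj s (u r) = u s].

Definition profree := set_type coherent.

HB.instance Definition _ := Topological.on profree.

Lemma vprojM (r s : vcong) (x y : vquot r) : subrel r s ->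
  vproj s (x * y)%g = (vproj s x * vproj s y)%g.
Proof.
move=> rs; rewrite /vproj -[RHS]vpiM; apply/vpiP/rs/vpiP.
by rewrite vreprK.
Qed.

Lemma coherentM (u v : profree) :
  (fun r => (val u r * val v r)%g) \in coherent.
Proof.
have uP := set_mem (valP u); have vP := set_mem (valP v).
by apply/mem_set => r s rs; rewrite vprojM // uP // vP.
Qed.

Definition profree_mul (u v : profree) : profree :=
  exist (fun f => f \in coherent) _ (coherentM u v).

Lemma profree_mulA : associative profree_mul.
Proof.
move=> u v w; apply: val_inj; apply/functional_extensionality_dep => r.
exact: mulgA.
Qed.

HB.instance Definition _ := isSemigroup.Build profree profree_mulA.

Lemma coherent_word (w : word A) : (fun r => vpi r w) \in coherent.
Proof.
by apply/mem_set => r s rs; apply/vpiP/rs/vpiP; rewrite vreprK.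
Qed.

Definition profree_word (w : word A) : profree :=
  exist (fun f => f \in coherent) _ (coherent_word w).

End FreeProfinite.

Definition is_factor (S : semigroupType) (x u : S) : Prop :=
  [\/ u = x, exists a, u = (a * x)%g, exists b, u = (x * b)%g
    | exists a b, u = (a * x * b)%g].

Section Subshifts.
Variable A : finType.

Definition biseq := {ptws int -> discrete_topology A}.

Definition shift (x : biseq) : biseq := fun i => x (i + 1)%R.

Definition is_subshift (X : set biseq) : Prop :=
  [/\ X !=set0, closed X & shift @` X = X].

Definition language (X : set biseq) : set (word A) :=
  [set w | exists (x : biseq) (i : int),
    X x /\ val w = mkseq (fun k => x (i + k%:Z)%R) (size (val w))].

(* fset_set is junk on infinite sets; for n > 0 this set is finite. *)
Definition nb_periodic (X : set biseq) (n : nat) : nat :=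
  #|` fset_set [set x | X x /\ iter n shift x = x]|.

End Subshifts.

(* Formal power series over rat are represented by their coefficients. For f  *)
(* with f 0 = 0, f ^ k has no term of degree < k, so that truncating both f    *)
(* and the exponential series at n does not affect the coefficient of t ^ n.   *)
Definition fps_exp (f : nat -> rat) (n : nat) : rat :=
  (\sum_(k < n.+1) (k`!%:R^-1 *: (\poly_(i < n.+1) f i) ^+ k)%R)%R`_n%R.

Definition zeta (A : finType) (X : set (biseq A)) : nat -> rat :=
  fps_exp (fun n => if n is 0%N then 0%R else ((nb_periodic X n)%:R / n%:R)%R).

Definition mirage (V : finSemigroupType -> Prop) (A : finType)
    (X : set (biseq A)) : set (profree V A) :=
  [set u | forall w : word A, is_factor (profree_word V w) u -> language X w].

Arguments mirage V {A} X.

(* Only the data of a topological category, which are all that isomorphisms   *)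
(* refer to. Composition is given by its graph: is_comp a b c means that       *)
(* dom a = cod b and that c is the composite (first b, then a). For mirages,   *)
(* closure under composition and compactness are theorems that need V to       *)
(* contain all local semilattices.                                             *)
Record topCategoryData := TopCategoryData {
  obj : topologicalType;
  arr : topologicalType;
  dom : arr -> obj;
  cod : arr -> obj;
  ident : obj -> arr;
  is_comp : arr -> arr -> arr -> Prop
}.

Definition homeomorphism (T U : topologicalType) (f : T -> U) : Prop :=
  exists g : U -> T, [/\ cancel f g, cancel g f, continuous f & continuous g].

Definition top_category_iso (C D : topCategoryData) : Prop :=
  exists (F : obj C -> obj D) (G : arr C -> arr D),
    [/\ homeomorphism F, homeomorphism G,
        (forall a, dom (G a) = F (dom a)) /\ (forall a, cod (G a) = F (cod a)),
        (forall e, G (ident e) = ident (F e))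
      & forall a b c, is_comp a b c <-> is_comp (G a) (G b) (G c)].

Section KMirage.
Variables (V : finSemigroupType -> Prop) (A : finType) (X : set (biseq A)).

Local Notation F := (profree V A).
Local Notation M := (mirage V X).

Definition K_obj : set F := [set e | M e /\ (e * e = e)%g].

Definition K_arr : set (F * F * F) :=
  [set a | [/\ K_obj a.1.1, K_obj a.2, M a.1.2
             & a.1.2 = (a.1.1 * a.1.2 * a.2)%g]].

Definition K_dom (a : K_arr) : K_obj :=
  exist (fun e => e \in K_obj) (val a).2
    (mem_set (let: And4 _ h _ _ := set_mem (valP a) in h)).

Definition K_cod (a : K_arr) : K_obj :=
  exist (fun e => e \in K_obj) (val a).1.1
    (mem_set (let: And4 h _ _ _ := set_mem (valP a) in h)).

Lemma K_ident_subproof (e : K_obj) : (val e, val e, val e) \in K_arr.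
Proof. by case/set_mem: (valP e) => Me ee; apply/mem_set; split; rewrite //= !ee. Qed.

Definition K_ident (e : K_obj) : K_arr :=
  exist (fun a => a \in K_arr) _ (K_ident_subproof e).

Definition K_comp (a b c : K_arr) : Prop :=
  K_dom a = K_cod b /\
  val c = ((val a).1.1, ((val a).1.2 * (val b).1.2)%g, (val b).2).

Definition K_mirage : topCategoryData :=
  @TopCategoryData K_obj K_arr K_dom K_cod K_ident K_comp.

End KMirage.

(* Main.v *)
(* Idempotents e and f of the mirage are isomorphic objects exactly when       *)
(* e = pq and f = qp for some p, q. An idempotent e has an infinite prefix and *)
(* an infinite suffix; joined at the origin they form a point of X, the trace  *)
(* of e. Cutting e after its first letter gives an isomorphic idempotent whose *)
(* trace is the shifted one, and every finite factor of e starts at the origin *)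
(* in the trace of some idempotent isomorphic to e. If the isomorphism class   *)
(* of e is finite, the traces of its members are thus periodic, with a common  *)
(* period N; so every finite factor of e is N-periodic, and by density         *)
(* e = u^omega, where u is the prefix of length N of e. Conversely, the class  *)
(* of u^omega has one member for each point in the orbit of the periodic       *)
(* point of period u. Hence the points fixed by the n-th power of the shift    *)
(* correspond to the objects whose isomorphism class is finite of cardinality  *)
(* dividing n, and their number is determined by the category alone.           *)
(* Local semilattices enter through the quotients of A^+ that remember the     *)
(* prefix and the suffix of length m and the factors of length m+1.            *)

Require Import Defs.
From HB Require Import structures.
From mathcomp Require Import all_boot all_order all_algebra.
From mathcomp Require Import finmap.
From mathcomp Require Import boolp classical_sets functions cardinality filter.
From mathcomp Require Import topology.
From mathcomp Require Import zify.

Set Implicit Arguments.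
Unset Strict Implicit.
Unset Printing Implicit Defensive.

Import GRing.Theory.

(** * Finite-index congruences and profiles of words *)

(** Isomorphism of objects is conjugacy of idempotents ([K_obj_iso]), so the sizes of conjugacy
    classes are invariants of the category. By [per_obj_card], [trace] maps the objects whose class
    size divides n bijectively onto the points fixed by the n-th power of the shift; the inverse
    sends x to the omega power of x_0 .. x_(n-1).

    The pivot is [conj_class_dvd]. A finite class forces periodicity, by pigeonhole on shifted
    traces ([shift_conj], [factor_cut], [conj_class_periodic]); conversely, periodic factors
    determine the idempotent ([periodic_factors_om]) and its class ([periodic_conj_class]).

    Two tools link pseudowords to words. Profile quotients are locally semilattices
    ([profile_quo_locally_semilattice]), so prefixes, suffixes and short factors of an idempotent
    can be read on any representative modulo [lcong m]. Compactness, through an ultrafilter on the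
    congruences, turns approximate factorizations into exact ones ([ultralimit],
    [factor_of_approx]). *)

Section FiniteCongruence.
Variable A : finType.

(** The finite type carries no product: only the kernel of the map has to be compatible with
    concatenation, and the product is put on the image [fcquo]. *)
Record fincong := FinCong {
  fc_type : finType;
  fc_map :> word A -> fc_type;
  fcM : forall u u' v v', fc_map u = fc_map u' -> fc_map v = fc_map v' ->
    fc_map (u * v)%g = fc_map (u' * v')%g
}.

Variable c : fincong.

Definition fcquo := {t : fc_type c | `[< exists w, c w = t >]}.

HB.instance Definition _ := Finite.on fcquo.

Definition fccls (w : word A) : fcquo :=
  exist (fun t => `[< exists w, c w = t >]) (c w)
    (introT (asboolP _) (ex_intro _ w erefl)).

Definition fcrep (x : fcquo) : word A := sval (cid (asboolW (valP x))).

Lemma fcrepK : cancel fcrep fccls.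
Proof.
by move=> x; apply: val_inj; exact: (svalP (cid (asboolW (valP x)))).
Qed.

Lemma fcclsP u v : fccls u = fccls v <-> c u = c v.
Proof. by split=> [/(congr1 val)//|E]; apply: val_inj. Qed.

Definition fcmul (x y : fcquo) : fcquo := fccls (fcrep x * fcrep y)%g.

Lemma fcclsM_subproof u v : fccls (u * v)%g = fcmul (fccls u) (fccls v).
Proof. by apply/fcclsP/fcM; apply/fcclsP; rewrite fcrepK. Qed.

Lemma fcmulA : associative fcmul.
Proof.
move=> x y z; rewrite -[x]fcrepK -[y]fcrepK -[z]fcrepK -!fcclsM_subproof.
by rewrite mulgA.
Qed.

HB.instance Definition _ := isSemigroup.Build fcquo fcmulA.

Lemma fccls_hom : is_hom fccls.
Proof. exact: fcclsM_subproof. Qed.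

Lemma fccls_surj (x : fcquo) : exists w, fccls w = x.
Proof. by exists (fcrep x); exact: fcrepK. Qed.

Lemma fcquo_gt0 (a : word A) : 0 < #|{: fcquo}|.
Proof. exact: leq_ltn_trans (leq0n _) (ltn_ord (enum_rank (fccls a))). Qed.

Definition kercong (V : finSemigroupType -> Prop) (Vc : V fcquo) : vcong V A.
Proof.
exists (fun u v => c u == c v); exists fcquo, fccls.
split=> [//|||u v]; [exact: fccls_hom|exact: fccls_surj|].
by apply/eqP/eqP => /fcclsP.
Defined.

Lemma kercongP (V : finSemigroupType -> Prop) (Vc : V fcquo) u v :
  vpi (kercong Vc) u = vpi (kercong Vc) v <-> c u = c v.
Proof. by split=> [/vpiP/eqP|E]//; apply/vpiP/eqP. Qed.

End FiniteCongruence.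

(** * Profiles: prefix, suffix and short factors of a word *)

Section Profile.
Variable A : finType.
Implicit Types (u v w x y : seq A) (m : nat).

(** The suffix is stored reversed, so that facts on [take] serve both ends. The bound m+1 on factors
    fits the bound m at the ends: a factor straddling a product splits into two nonempty pieces of
    length at most m. *)
Definition profile m w : m.-bseq A * m.-bseq A * {set m.+1.-bseq A} :=
  (insub_bseq m (take m w), insub_bseq m (take m (rev w)),
   [set v : m.+1.-bseq A | infix v w]).

Lemma profileP m v w :
  profile m v = profile m w <->
  [/\ take m v = take m w, take m (rev v) = take m (rev w)
    & forall x, size x <= m.+1 -> infix x v = infix x w].
Proof.
have tm s : size (take m s) <= m by rewrite size_take_min geq_minl.
split=> [E|[pvw svw ivw]].
  split.
  - by have := congr1 (fun p => val p.1.1) E; rewrite !val_insubd !tm.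
  - by have := congr1 (fun p => val p.1.2) E; rewrite !val_insubd !tm.
  - by move=> x xm; have /setP/(_ (Bseq xm)) := congr1 snd E; rewrite !inE.
congr (_, _, _); [by rewrite pvw|by rewrite svw|].
by apply/setP => x; rewrite !inE ivw // size_bseq.
Qed.

Lemma take_catW m x y : take m (x ++ y) = take m (take m x ++ take m y).
Proof.
have [mx|xm] := leqP m (size x); last first.
  rewrite (take_oversize (ltnW xm)) !take_cat ltnNge (ltnW xm) /= take_takel //.
  exact: leq_subr.
rewrite takel_cat // takel_cat ?size_takel //.
by rewrite (take_oversize (_ : size (take m x) <= m)) // size_takel.
Qed.

Lemma infix_cat v x y : infix v (x ++ y) ->
  [\/ infix v x, infix v y | exists v1 v2,
    [/\ v = v1 ++ v2, v1 != [::], v2 != [::], suffix v1 x & prefix v2 y]].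
Proof.
elim: x => [|a x IHx]; first by constructor 2.
rewrite cat_cons infix_consl -cat_cons => /orP[|/IHx].
  rewrite prefixE take_cat; case: ltnP => [vx /eqP Ev|vx /eqP Ev].
    by constructor 1; rewrite -Ev prefixW // prefix_take.
  set v2 := take _ y in Ev; have [v20|v2N] := eqVneq v2 [::].
    by constructor 1; rewrite -Ev v20 cats0 infix_refl.
  constructor 3; exists (a :: x), v2; split=> //; first exact: suffix_refl.
  exact: prefix_take.
case=> [vx|vy|[v1 [v2 [-> v10 v20 s1 p2]]]].
- by constructor 1; rewrite infix_consl vx orbT.
- by constructor 2.
- constructor 3; exists v1, v2; split=> //.
  by rewrite -cat1s; apply: suffix_catr.
Qed.

Lemma infix_cat_suffix_prefix v1 v2 x y :
  suffix v1 x -> prefix v2 y -> infix (v1 ++ v2) (x ++ y).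
Proof.
by move=> /suffixP[s ->] /prefixP[t ->]; rewrite -!catA (catA v1) infix_infix.
Qed.

Lemma prefix_takeE m v x : size v <= m -> prefix v (take m x) = prefix v x.
Proof. by move=> vm; rewrite !prefixE take_takel. Qed.

Lemma suffix_takeE m v x :
  size v <= m -> suffix v x = prefix (rev v) (take m (rev x)).
Proof. by move=> vm; rewrite prefix_takeE ?size_rev // prefix_rev. Qed.

Lemma profile_cat_infix m x x' y y' : profile m x = profile m x' ->
  profile m y = profile m y' ->
  forall v, size v <= m.+1 -> infix v (x ++ y) -> infix v (x' ++ y').
Proof.
move=> /profileP[px sx ix] /profileP[py sy iy] v vm /infix_cat[vx|vy|].
- by rewrite infix_catr // -ix.
- by rewrite infix_catl // -iy.
- case=> v1 [v2 [Ev v10 v20 s1 p2]]; rewrite Ev in vm *.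
  move: v10 v20 vm; rewrite size_cat -!size_eq0 -!lt0n => v10 v20 vm.
  have v1m : size v1 <= m by rewrite -ltnS (leq_trans _ vm) // -addn1 leq_add2l.
  have v2m : size v2 <= m by rewrite -ltnS (leq_trans _ vm) // -add1n leq_add2r.
  apply: infix_cat_suffix_prefix.
    by rewrite (suffix_takeE _ v1m) -sx -suffix_takeE.
  by rewrite -(prefix_takeE _ v2m) -py prefix_takeE.
Qed.

Lemma profile_cat m x x' y y' : profile m x = profile m x' ->
  profile m y = profile m y' -> profile m (x ++ y) = profile m (x' ++ y').
Proof.
move=> ex ey; have [px sx _] := (profileP m x x').1 ex.
have [py sy _] := (profileP m y y').1 ey.
apply/profileP; split.
- by rewrite take_catW px py -take_catW.
- by rewrite !rev_cat take_catW sx sy -take_catW.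
- move=> v vm; apply/idP/idP; last by move: vm; apply: profile_cat_infix.
  by move: vm; apply: profile_cat_infix.
Qed.

Lemma profileW m k v w : k <= m -> profile m v = profile m w ->
  profile k v = profile k w.
Proof.
move=> km /profileP[p s i]; apply/profileP; split.
- by rewrite -(take_takel _ km) p take_takel.
- by rewrite -(take_takel _ km) s take_takel.
- by move=> x xk; rewrite i // (leq_trans xk).
Qed.

Definition profile_cong m : fincong A :=
  @FinCong A _ (fun a : word A => profile m (val a))
    (fun a a' b b' (eab : profile m (val a) = profile m (val a')) =>
       profile_cat eab).

(** A short factor across the middle already lies in w w, as w is long enough to contain each piece;
    and w w has the same short factors as w. *)
Lemma infix_through_idempotent m w x y v :
  m <= size w -> profile m (w ++ w) = profile m w -> size v <= m.+1 ->
  infix v ((x ++ w) ++ (w ++ y)) = infix v (x ++ w) || infix v (w ++ y).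
Proof.
move=> mw /profileP[_ _ ww] vm; apply/idP/idP; last first.
  by case/orP => ?; [apply: infix_catr|apply: infix_catl].
case/infix_cat=> [->|->|[v1 [v2 [Ev v10 v20 s1 p2]]]] //; first by rewrite orbT.
rewrite Ev in vm *.
move: v10 v20; rewrite -!size_eq0 -!lt0n => v10 v20.
have v1m : size v1 <= m.
  by rewrite -ltnS (leq_trans _ vm) // size_cat -addn1 leq_add2l.
have v2m : size v2 <= m.
  by rewrite -ltnS (leq_trans _ vm) // size_cat -add1n leq_add2r.
suff h : infix (v1 ++ v2) w by rewrite (infix_catr _ h) orbT.
rewrite -ww //; apply: infix_cat_suffix_prefix.
  move: s1; rewrite !(suffix_takeE _ v1m) rev_cat takel_cat //.
  by rewrite size_rev.
by move: p2; rewrite -(prefix_takeE (w ++ y) v2m) takel_cat // prefix_takeE.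
Qed.

Lemma profile_congP m (a b : word A) :
  profile_cong m a = profile_cong m b <-> profile m (val a) = profile m (val b).
Proof. exact: iff_refl. Qed.

(** Elements of eSe are classes of words w s w, where w is long and represents e. They have the
    prefix and suffix of w, and the factors of a product of two of them form the union of their
    factor sets: union is idempotent and commutative. *)
Lemma profile_quo_locally_semilattice m (a : word A) :
  locally_semilattice (fcquo (profile_cong m)).
Proof.
move: (profile_cong m) (@profile_congP m) => c cP.
split; first exact: (fcquo_gt0 c a).
move=> e ee.
have [w [we mw]] : exists w : word A, fccls c w = e /\ m <= size (val w).
  have [w0 we0] := fccls_surj e.
  elim: (m) => [|j [w [we jw]]]; first by exists w0.
  exists (w0 * w)%g; rewrite fccls_hom we0 we ee; split=> //.
  by rewrite /= size_cat -add1n leq_add // lt0n size_eq0 (valP w0).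
have ww : profile m (val w ++ val w) = profile m (val w).
  by apply/(cP (w * w)%g)/fcclsP; rewrite fccls_hom we.
have pre x : take m (val w ++ x) = take m (val w) by rewrite takel_cat.
have suf x : take m (rev (x ++ val w)) = take m (rev (val w)).
  by rewrite rev_cat takel_cat // size_rev.
have fact s t : forall v, size v <= m.+1 ->
    infix v ((val w ++ s ++ val w) ++ (val w ++ t ++ val w)) =
    infix v (val w ++ s ++ val w) || infix v (val w ++ t ++ val w).
  by move=> v vm; rewrite !(catA _ s) (@infix_through_idempotent m).
have eseE (x : fcquo c) : (exists s, x = (e * s * e)%g) ->
    exists s : word A, x = fccls c (w * s * w)%g.
  by case=> s ->; have [v <-] := fccls_surj s; exists v; rewrite !fccls_hom we.
split=> [_ /eseE[s ->]|_ _ /eseE[s ->] /eseE[t ->]].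
  rewrite -fccls_hom; apply/fcclsP/cP/profileP; rewrite /= -!catA; split.
  - by rewrite !pre.
  - by rewrite !catA !suf.
  - move=> v vm.
    by have := fact (val s) (val s) v vm; rewrite -!catA => ->; rewrite orbb.
rewrite -!fccls_hom; apply/fcclsP/cP/profileP; rewrite /= -!catA; split.
- by rewrite !pre.
- by rewrite !catA !suf.
- move=> v vm.
  have := fact (val s) (val t) v vm; rewrite -!catA => ->.
  by have := fact (val t) (val s) v vm; rewrite -!catA => ->; rewrite orbC.
Qed.

End Profile.

(** * Words and bi-infinite sequences *)

Section Words.
Variable A : finType.
Implicit Types (u v w : word A).

(* [wpow w k] is the power w^(k+1), and [wseg x i n] is x_i .. x_(i+n), of     *)
(* length n+1: exponents and lengths are shifted because words are nonempty.   *)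
Definition wpow w k : word A := iter k (fun v => (w * v)%g) w.

Definition wseg (x : biseq A) (i : int) n : word A :=
  exist _ (mkseq (fun k => x (i + k%:Z)%R) n.+1) isT.

Lemma size_word w : 0 < size (val w).
Proof. by rewrite lt0n size_eq0 (valP w). Qed.

Lemma cat_word_neq_nil (s : seq A) w : s ++ val w != [::].
Proof.
by rewrite -size_eq0 size_cat addn_eq0 negb_and !size_eq0 (valP w) orbT.
Qed.

Lemma wpowD w j k : (wpow w j * wpow w k)%g = wpow w (j + k).+1.
Proof. by elim: j => [|j IHj] //=; rewrite -mulgA IHj. Qed.

Lemma wpow_wpow w j k : wpow (wpow w j) k = wpow w (j * k + j + k).
Proof.
elim: k => [|k IHk] /=; first by rewrite muln0 addn0.
by rewrite IHk wpowD; congr wpow; lia.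
Qed.

Lemma size_wpow w k : size (val (wpow w k)) = k.+1 * size (val w).
Proof. by elim: k => [|k IHk]; rewrite ?mul1n //= size_cat IHk. Qed.

Lemma size_wseg x i n : size (val (wseg x i n)) = n.+1.
Proof. by rewrite /= size_map size_iota. Qed.

Lemma nth_wseg a0 x i n k : k <= n ->
  nth a0 (val (wseg x i n)) k = x (i + k%:Z)%R.
Proof. by move=> kn; rewrite nth_mkseq. Qed.

Lemma word_eqP a0 v w : size (val v) = size (val w) ->
  (forall k, k < size (val v) -> nth a0 (val v) k = nth a0 (val w) k) -> v = w.
Proof. by move=> sz vw; apply: val_inj; apply: (eq_from_nth (x0 := a0)). Qed.

Lemma eq_wseg a0 x i n v : size (val v) = n.+1 ->
  (forall k, k <= n -> nth a0 (val v) k = x (i + k%:Z)%R) -> v = wseg x i n.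
Proof.
move=> sz vx; apply: (@word_eqP a0); first by rewrite size_wseg.
by rewrite sz => k kn; rewrite nth_wseg // vx.
Qed.

Lemma wsegM (a0 : A) x i m n :
  (wseg x i m * wseg x (i + m.+1%:Z)%R n)%g = wseg x i (m + n).+1.
Proof.
apply: (@eq_wseg a0) => [|k kmn].
  by rewrite -[LHS]/(size (_ ++ _)) size_cat !size_wseg addSn addnS.
rewrite -[LHS]/(nth _ (_ ++ _) _) nth_cat size_wseg; case: ltnP => km.
  by rewrite nth_wseg.
by rewrite nth_wseg; [congr x; lia|lia].
Qed.

Lemma infix_wseg (a0 : A) x i n v : infix (val v) (val (wseg x i n)) ->
  exists j, v = wseg x (i + j%:Z)%R (size (val v)).-1.
Proof.
case/infixP=> s [s' E]; exists (size s).
have E' := congr1 size E; rewrite size_wseg !size_cat in E'.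
apply: (@eq_wseg a0) => [|k]; first by rewrite prednK ?size_word.
rewrite -ltnS prednK ?size_word // => kv.
have -> : nth a0 (val v) k = nth a0 (val (wseg x i n)) (size s + k).
  rewrite E nth_cat ifN -?leqNgt ?leq_addr // addKn nth_cat ifT //.
rewrite nth_wseg; first by rewrite PoszD addrA.
by rewrite -ltnS E' -addnS leq_add2l (leq_trans kv) // leq_addr.
Qed.

Lemma iter_shift n (x : biseq A) i : iter n (@shift A) x i = x (i + n%:Z)%R.
Proof.
elim: n i => [|n IHn] i; first by rewrite addr0.
by rewrite iterS {1}/shift IHn; congr x; lia.
Qed.

Lemma shift_inj : injective (@shift A).
Proof.
move=> x y /(congr1 (fun z => z (_ - 1)%R)) xy; apply: funext => i.
by have := xy i; rewrite /shift subrK.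
Qed.

Lemma iter_shift_inj n : injective (iter n (@shift A)).
Proof. by elim: n => [|n IHn] x y //= /shift_inj/IHn. Qed.

Section Periodic.
Variables (x : biseq A) (N : nat).
Hypothesis xN : iter N (@shift A) x = x.

Lemma periodicE i : x (i + N%:Z)%R = x i.
Proof. by rewrite -{2}xN iter_shift. Qed.

Lemma periodicM c i : x (i + (c * N)%:Z)%R = x i.
Proof.
elim: c => [|c IHc]; first by rewrite mul0n addr0.
by rewrite -IHc -[in RHS]periodicE; congr x; lia.
Qed.

Lemma wseg_periodic c i n : wseg x (i + (c * N)%:Z)%R n = wseg x i n.
Proof.
apply: val_inj; apply: eq_mkseq => k.
by rewrite -[in RHS](periodicM c); congr x; lia.
Qed.

End Periodic.

Lemma wpow_wseg (a0 : A) x p k : iter p.+1 (@shift A) x = x ->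
  wpow (wseg x 0 p) k = wseg x 0 (k.+1 * p.+1).-1.
Proof.
move=> xp; elim: k => [|k IHk]; first by rewrite mul1n.
rewrite -[LHS]/(_ * wpow _ _)%g IHk.
have := wseg_periodic xp 1 0 (k.+1 * p.+1).-1; rewrite mul1n => <-.
by rewrite wsegM //; congr wseg; lia.
Qed.

End Words.

(** * Idempotent pseudowords *)

Section Profree.
Variables (V : finSemigroupType -> Prop) (hV : is_pseudovariety V).
Hypothesis hLSl : forall S : finSemigroupType, locally_semilattice S -> V S.
Variables (A : finType) (a0 : A).

Local Notation word := (word A).
Local Notation vcong := (vcong V A).
Local Notation profree := (profree V A).
Local Notation "% w" := (profree_word V w) (at level 2).
Implicit Types (r s t : vcong) (e f : profree).

Definition letter (a : A) : word := exist _ [:: a] isT.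

Definition lcong m : vcong :=
  kercong (hLSl (profile_quo_locally_semilattice m (letter a0))).

Lemma lcongP m (u v : word) :
  vpi (lcong m) u = vpi (lcong m) v <-> profile m (val u) = profile m (val v).
Proof. exact: kercongP. Qed.

Lemma lcongW k m : k <= m -> subrel (lcong m) (lcong k).
Proof.
by move=> km u v /vpiP/lcongP E; apply/vpiP/lcongP; apply: profileW E.
Qed.

(** The quotient by the intersection embeds in the product of the two quotients, hence belongs to
    V. *)
Lemma vcong_meet r s : exists t, subrel t r /\ subrel t s.
Proof.
have [S [phi [VS phiM _ rE]]] := vrelP r.
have [T [psi [VT psiM _ sE]]] := vrelP s.
have cM u u' v v' : (phi u, psi u) = (phi u', psi u') ->
    (phi v, psi v) = (phi v', psi v') ->
    (phi (u * v)%g, psi (u * v)%g) = (phi (u' * v')%g, psi (u' * v')%g).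
  by case=> eu1 eu2 [ev1 ev2]; rewrite !phiM !psiM eu1 eu2 ev1 ev2.
pose c := @FinCong A (S * T)%type (fun w => (phi w, psi w)) cM.
pose ST (b : bool) : finSemigroupType := if b then S else T.
pose f (x : fcquo c) : dprod_semigroup ST :=
  [ffun b : bool => if b return ST b then (val x).1 else (val x).2].
have Vc : V (fcquo c).
  apply: (@pv_sub V hV _ (dprod_semigroup ST) f).
  - exact: (fcquo_gt0 c (letter a0)).
  - move=> x y; have [u <-] := fccls_surj x; have [v <-] := fccls_surj y.
    by rewrite -fccls_hom; apply/ffunP => -[]; rewrite !ffunE /= ?phiM ?psiM.
  - move=> x y /ffunP E; have := E true; have := E false.
    rewrite !ffunE => E2 E1.
    by apply: val_inj; case: (val x) (val y) E1 E2 => [? ?] [? ?] /= -> ->.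
  - by apply: pv_prod => // -[].
exists (kercong Vc).
by split=> u v /vpiP/kercongP -[E1 E2]; rewrite ?rE ?sE ?E1 ?E2 eqxx.
Qed.

(** * Components and compactness of the free pro-V semigroup *)

Lemma vproj_vpi r s (w : word) : subrel r s -> vproj s (vpi r w) = vpi s w.
Proof. by move=> rs; apply/vpiP/rs/vpiP; rewrite vreprK. Qed.

Definition pcomp e r : vquot r := val e r.

Lemma pcompM e f r : pcomp (e * f)%g r = (pcomp e r * pcomp f r)%g.
Proof. by []. Qed.

Lemma pcomp_word (w : word) r : pcomp (% w) r = vpi r w.
Proof. by []. Qed.

Lemma profree_eq e f : (forall r, pcomp e r = pcomp f r) -> e = f.
Proof.
move=> ef; apply: val_inj; apply/functional_extensionality_dep => r.
exact: ef.
Qed.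

Lemma profree_coherent e r s (w : word) : subrel r s ->
  vpi r w = pcomp e r -> vpi s w = pcomp e s.
Proof.
move=> rs E; have eP := set_mem (valP e).
by rewrite -(vproj_vpi w rs) E; exact: eP.
Qed.

Lemma profree_repr e r : exists w, vpi r w = pcomp e r.
Proof. by exists (vrepr (pcomp e r)); rewrite vreprK. Qed.

Lemma vpi_profree_mul e f r (u v : word) :
  vpi r u = pcomp e r -> vpi r v = pcomp f r ->
  vpi r (u * v)%g = pcomp (e * f)%g r.
Proof. by move=> Eu Ev; rewrite vpiM Eu Ev. Qed.

(** The sets of refinements form a filter base by [vcong_meet]. Limits along U play the part of
    convergent subnets. *)
Lemma refinement_ultrafilter : exists U : set_system vcong,
  UltraFilter U /\ forall r, U [set t | subrel t r]%classic.
Proof.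
pose D : set vcong := setT.
pose B r : set vcong := [set t | subrel t r]%classic.
have FB : Filter (filter_from D B).
  apply: filter_from_filter; first by exists (lcong 0).
  move=> r s _ _; have [t [tr ts]] := vcong_meet r s.
  by exists t => // u ut; split=> x y /ut; [exact: tr|exact: ts].
have PF : ProperFilter (filter_from D B).
  by apply: filter_from_proper => // r _; exists r.
have [U [UU FU]] := ultraFilterLemma PF.
by exists U; split=> // r; apply: FU; exists r.
Qed.

Lemma ultrafilter_pigeonhole (T : Type) (U : set_system T) (S : finType)
    (f : T -> S) : UltraFilter U -> exists y, U (f @^-1` [set y])%classic.
Proof.
move=> UU; apply: contrapT => /forallNP nU.
have UF := @ultra_proper _ _ UU.
have avoid (l : seq S) : U [set x | f x \notin l]%classic.
  elim: l => [|y l IHl]; first by apply: filterS filterT => x.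
  have [/nU//|Uy] := in_ultra_setVsetC (f @^-1` [set y])%classic UU.
  apply: filterS (filterI Uy IHl) => x [/= /eqP xy xl].
  by rewrite inE negb_or xy.
by have [x /=] := filter_ex (avoid (enum S)); rewrite mem_enum.
Qed.

(** In each finite quotient the values are constant on a member of U; coherence holds because two
    members of U meet. *)
Lemma ultralimit (U : set_system vcong) (al : vcong -> word) :
  UltraFilter U -> (forall r, U [set t | subrel t r]%classic) ->
  exists a : profree, forall r, U [set t | vpi r (al t) = pcomp a r]%classic.
Proof.
move=> UU Ur; have UF := @ultra_proper _ _ UU.
have lim r : {x : vquot r | U [set t | vpi r (al t) = x]%classic}.
  apply: cid; have [S [phi [_ _ _ rE]]] := vrelP r.
  have [s Us] := ultrafilter_pigeonhole (phi \o al) UU.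
  have [t0 /= t0s] := filter_ex Us.
  exists (vpi r (al t0)); apply: filterS Us => t /= ts.
  by apply/vpiP; rewrite rE ts t0s.
have ac : (fun r => sval (lim r)) \in @coherent V A.
  apply/mem_set => r s rs.
  have [t [/= <- <-]] := filter_ex (filterI (svalP (lim r)) (svalP (lim s))).
  exact: vproj_vpi.
exists (exist (fun z => z \in @coherent V A) _ ac) => r.
exact: svalP (lim r).
Qed.

Lemma factor_of_approx e r0 (v : word) :
  (forall t, subrel t r0 ->
    exists u w : word, vpi t (u * v * w)%g = pcomp e t) ->
  exists a b, e = (a * % v * b)%g.
Proof.
move=> ap; have [U [UU Ur]] := refinement_ultrafilter.
have UF := @ultra_proper _ _ UU.
pose P t (p : word * word) :=
  subrel t r0 -> vpi t (p.1 * v * p.2)%g = pcomp e t.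
have /choice[uw uwP] t : exists p, P t p.
  (* A dummy pair elsewhere is harmless: the refinements of r0 belong to U. *)
  have [tr|ntr] := pselect (subrel t r0); last by exists (v, v).
  by have [u [w E]] := ap t tr; exists (u, w).
have [a aP] := ultralimit (fun t => (uw t).1) UU Ur.
have [b bP] := ultralimit (fun t => (uw t).2) UU Ur.
exists a, b; apply: profree_eq => r.
have [t [[[/= tr0 tr] ta] tb]] :=
  filter_ex (filterI (filterI (filterI (Ur r0) (Ur r)) (aP r)) (bP r)).
rewrite -(profree_coherent tr (uwP t tr0)).
exact: (vpi_profree_mul (vpi_profree_mul ta (esym (pcomp_word v r))) tb).
Qed.

Lemma prefix_of_approx e r0 (v : word) :
  (forall t, subrel t r0 -> exists w : word, vpi t (v * w)%g = pcomp e t) ->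
  exists b, e = (% v * b)%g.
Proof.
move=> ap; have [U [UU Ur]] := refinement_ultrafilter.
have UF := @ultra_proper _ _ UU.
pose P t w := subrel t r0 -> vpi t (v * w)%g = pcomp e t.
have /choice[w wP] t : exists w, P t w.
  have [tr|ntr] := pselect (subrel t r0); last by exists v.
  by have [w E] := ap t tr; exists w.
have [b bP] := ultralimit w UU Ur.
exists b; apply: profree_eq => r.
have [t [[/= tr0 tr] tb]] :=
  filter_ex (filterI (filterI (Ur r0) (Ur r)) (bP r)).
rewrite -(profree_coherent tr (wP t tr0)).
exact: (vpi_profree_mul (esym (pcomp_word v r)) tb).
Qed.

(** * Idempotents: representatives, traces, conjugacy *)

Lemma idem_approx e r k : (e * e)%g = e ->
  exists z : word, vpi r z = pcomp e r /\ k <= size (val z).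
Proof.
move=> ee; have [z0 z0e] := profree_repr e r.
elim: k => [|k [z [ze kz]]]; first by exists z0.
exists (z0 * z)%g; rewrite -[in RHS]ee; split.
  exact: vpi_profree_mul.
by rewrite size_cat -add1n leq_add ?size_word.
Qed.

Lemma idem_approx2 e r s k : (e * e)%g = e ->
  exists z : word,
    [/\ vpi r z = pcomp e r, vpi s z = pcomp e s & k <= size (val z)].
Proof.
move=> ee; have [t [tr ts]] := vcong_meet r s.
have [z [ze kz]] := idem_approx t k ee.
by exists z; split=> //; apply: profree_coherent ze.
Qed.

Lemma idem_wpow e r z k : (e * e)%g = e ->
  vpi r z = pcomp e r -> vpi r (wpow z k) = pcomp e r.
Proof.
move=> ee ze; elim: k => [|k IHk] //=.
by rewrite -[in RHS]ee; apply: vpi_profree_mul.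
Qed.

(* Meaningful for idempotents only: their powers provide representatives of   *)
(* arbitrary length, so that the default letter a0 is never read.              *)
Definition trace e : biseq A := fun i =>
  match i with
  | Posz n => nth a0 (val (wpow (vrepr (pcomp e (lcong n.+1))) n)) n
  | Negz n => nth a0 (rev (val (wpow (vrepr (pcomp e (lcong n.+1))) n))) n
  end.

Lemma trace_approx e m (z : word) n : (e * e)%g = e ->
  vpi (lcong m) z = pcomp e (lcong m) -> n < m ->
  [/\ n < size (val z), nth a0 (val z) n = trace e (Posz n)
    & nth a0 (rev (val z)) n = trace e (Negz n)].
Proof.
move=> ee zm nm; set y := wpow (vrepr (pcomp e (lcong n.+1))) n.
have ye : vpi (lcong n.+1) y = pcomp e (lcong n.+1).
  by apply: idem_wpow => //; rewrite vreprK.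
have /lcongP/profileP[pzy szy _] : vpi (lcong n.+1) z = vpi (lcong n.+1) y.
  by rewrite ye; apply: profree_coherent zm; apply: lcongW.
split.
- have := congr1 size pzy; rewrite !size_take_min size_wpow.
  have := size_word (vrepr (pcomp e (lcong n.+1))).
  by move: (size _) => p; move: (size _) => q; nia.
- by rewrite -(nth_take _ (ltnSn n)) pzy nth_take.
- by rewrite -(nth_take _ (ltnSn n)) szy nth_take.
Qed.

(** The cut between the two copies of z is the origin of the trace. *)
Lemma trace_approx_sq e m (z : word) i j : (e * e)%g = e ->
  vpi (lcong m) z = pcomp e (lcong m) ->
  Posz j = (Posz (size (val z)) + i)%R -> (- m%:Z <= i < m%:Z)%R ->
  nth a0 (val z ++ val z) j = trace e i.
Proof.
move=> ee zm; case: i => n jE im; rewrite nth_cat.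
  have /(trace_approx ee zm)[_ <- _] : n < m by lia.
  by rewrite ifN; [congr nth; lia|lia].
have /(trace_approx ee zm)[nz _ <-] : n < m by lia.
rewrite ifT; last by lia.
by rewrite nth_rev //; congr nth; lia.
Qed.

Lemma idem_factor e m z (v : word) : (e * e)%g = e ->
  vpi (lcong m) z = pcomp e (lcong m) -> infix (val v) (val z) ->
  size (val v) <= m.+1 -> exists a b, e = (a * % v * b)%g.
Proof.
move=> ee zm vz vm; apply: (@factor_of_approx _ (lcong m)) => t tm.
have [y ye] := profree_repr e t.
have /lcongP/profileP[_ _ yz] : vpi (lcong m) y = vpi (lcong m) z.
  by rewrite zm; apply: profree_coherent ye.
move: vz; rewrite -yz // => /infixP[s [s' E]].
have ys : val y ++ s != [::] by case: (y) => -[].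
have sy : s' ++ val y != [::] by exact: cat_word_neq_nil.
pose l : word := exist (fun w => w != [::]) _ ys.
pose r : word := exist (fun w => w != [::]) _ sy.
(* Since e = e e e, the word y y y also represents e; its outer copies of y keep both cofactors
   nonempty. *)
exists l, r; have -> : (l * v * r = y * (y * y))%g.
  apply: val_inj; rewrite -[LHS]/((_ ++ _) ++ _) -[RHS]/(_ ++ _ ++ _) -!catA.
  by congr (_ ++ _); rewrite [X in _ = X ++ _]E -!catA.
have -> : e = (e * (e * e))%g by rewrite !ee.
exact: (vpi_profree_mul ye (vpi_profree_mul ye ye)).
Qed.

Lemma factor_infix e m z (v : word) a b : e = (a * % v * b)%g ->
  vpi (lcong m) z = pcomp e (lcong m) -> size (val v) <= m.+1 ->
  infix (val v) (val z).
Proof.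
move=> -> zm vm; have [x xa] := profree_repr a (lcong m).
have [y yb] := profree_repr b (lcong m).
have E := vpi_profree_mul (vpi_profree_mul xa (esym (pcomp_word v _))) yb.
have /lcongP/profileP[_ _ ->//] := etrans zm (esym E).
by rewrite -[X in infix _ X]/((_ ++ _) ++ _) -catA infix_infix.
Qed.

Lemma prefix_trace e (v : word) b i : (e * e)%g = e -> e = (% v * b)%g ->
  i < size (val v) -> nth a0 (val v) i = trace e (Posz i).
Proof.
move=> ee ev iv; have [y yb] := profree_repr b (lcong (size (val v))).
have E := vpi_profree_mul (esym (pcomp_word v _)) yb; rewrite -ev in E.
have [_ <- _] := trace_approx ee E iv.
by rewrite -[X in _ = nth _ X _]/(_ ++ _) nth_cat iv.
Qed.

Lemma trace_factor e i n : (e * e)%g = e ->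
  exists a b, e = (a * % (wseg (trace e) i n) * b)%g.
Proof.
(* The positions i, .., i+n lie in [-m, m), where z z displays the trace. *)
move=> ee; pose m := absz i + n.+1.
have [z [zm mz]] := idem_approx (lcong m) m ee.
apply: (@idem_factor e m (z * z)%g) => //.
- by rewrite -[in RHS]ee; apply: vpi_profree_mul.
- pose j := absz (Posz (size (val z)) + i)%R.
  have jE : Posz j = (Posz (size (val z)) + i)%R by rewrite /j; lia.
  suff -> : val (wseg (trace e) i n) = take n.+1 (drop j (val (z * z)%g)).
    apply/infixP; exists (take j (val (z * z)%g)).
    by exists (drop n.+1 (drop j (val (z * z)%g))); rewrite !cat_take_drop.
  rewrite -[val (z * z)%g]/(val z ++ val z).
  have szt : size (take n.+1 (drop j (val z ++ val z))) = n.+1.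
    by rewrite size_takel // size_drop size_cat; lia.
  apply: (@eq_from_nth _ a0) => [|k]; rewrite size_wseg ?szt // ltnS => kn.
  rewrite nth_wseg // nth_take // nth_drop.
  by rewrite (trace_approx_sq (i := (i + k%:Z)%R) ee zm) //; lia.
- by rewrite size_wseg; lia.
Qed.

Lemma trace_mirage X e : mirage V X e -> (e * e)%g = e ->
  forall i n, language X (wseg (trace e) i n).
Proof.
move=> Me ee i n; apply: Me; have [a [b E]] := trace_factor i n ee.
by constructor 4; exists a, b.
Qed.

(** On idempotents this is Green's relation D. *)
Definition idem_conj e f := exists p q, e = (p * q)%g /\ f = (q * p)%g.

Lemma idem_conj_factor e f : idem_conj e f ->
  exists a b, (e * e * e)%g = (a * f * b)%g.
Proof.
move=> [p [q [-> E]]]; exists p, (q * p * q)%g.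
by rewrite E !mulgA.
Qed.

Lemma idem_conj_trans e f g : (e * e)%g = e -> (f * f)%g = f -> (g * g)%g = g ->
  idem_conj e f -> idem_conj f g -> idem_conj e g.
Proof.
move=> ee ff gg [p [q [epq fqp]]] [r' [s' [frs gsr]]].
exists (p * r')%g, (s' * q)%g; split.
  by rewrite -[RHS]mulgA (mulgA r') -frs fqp !mulgA -epq -mulgA -epq ee.
by rewrite -[RHS]mulgA (mulgA q) -fqp frs !mulgA -gsr -mulgA -gsr gg.
Qed.

(* The conjugate [v b e a] of [e = a v b] is cut in front of v. *)
Lemma factor_cut e a (v : word) b : (e * e)%g = e -> e = (a * % v * b)%g ->
  exists f, [/\ (f * f)%g = f, idem_conj e f
    & forall i, i < size (val v) -> trace f (Posz i) = nth a0 (val v) i].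
Proof.
move=> ee E.
have [q qE] : exists q, q = (% v * b * e)%g by exists (% v * b * e)%g.
have eaq : (e * a * q)%g = e.
  by rewrite qE !mulgA -(mulgA e a) -(mulgA e _ b) -E !ee.
pose f := (q * (e * a))%g.
have ff : (f * f)%g = f.
  rewrite /f -!mulgA (mulgA e a) (mulgA (e * a)%g) eaq mulgA qE -!mulgA.
  by rewrite (mulgA e e) ee.
exists f; split=> //.
  by exists (e * a)%g, q.
move=> i iv; rewrite -(prefix_trace (v := v) (b := (b * e * (e * a))%g) ff) //.
by rewrite /f qE !mulgA.
Qed.

(** Write e = x (b e) with x the first letter, and take f = (b e) x. Representatives of f arise from
    those of e by moving x from the front to the end, so x lands just left of the origin. *)
Lemma shift_conj e : (e * e)%g = e -> exists f,
  [/\ (f * f)%g = f, idem_conj e f & trace f = shift (trace e)].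
Proof.
move=> ee; pose x := letter (trace e (Posz 0)).
have [b eb] : exists b, e = (% x * b)%g.
  apply: (@prefix_of_approx _ (lcong 1)) => t t1.
  have [z ze] := profree_repr e t.
  have [z0 E _] := trace_approx ee (profree_coherent t1 ze) (ltnSn 0).
  case Ez : (val z) z0 E => [//|c s] _ E.
  have sz : s ++ val z != [::] by exact: cat_word_neq_nil.
  pose w : word := exist (fun w => w != [::]) _ sz.
  exists w; have -> : (x * w = z * z)%g.
    by apply: val_inj; rewrite -[LHS]/(_ :: s ++ _) -[RHS]/(_ ++ _) {2}Ez /x -E.
  by rewrite -[e]ee; apply: vpi_profree_mul.
pose f := (b * e * % x)%g.
have exbe : (% x * (b * e))%g = e by rewrite mulgA -eb.
have ff : (f * f)%g = f.
  by rewrite /f -!mulgA (mulgA (% x) b) -eb (mulgA e e) ee (mulgA e e) ee.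
exists f; split=> //; first by exists (% x), (b * e)%g.
apply: funext => i.
(* Large enough to read both i and i+1. *)
pose m := (absz i).+2.
have [zb zbE] := profree_repr b (lcong m).
have [ze [zeE mze]] := idem_approx (lcong m) m ee.
have xE : vpi (lcong m) x = pcomp (% x) (lcong m) by [].
have fE := vpi_profree_mul (vpi_profree_mul zbE zeE) xE.
have eE : vpi (lcong m) (x * (zb * ze))%g = pcomp e (lcong m).
  by rewrite -exbe; apply: vpi_profree_mul xE (vpi_profree_mul zbE zeE).
have szx : val (zb * ze * x)%g = val zb ++ val ze ++ [:: trace e (Posz 0)].
  by rewrite -[LHS]/((_ ++ _) ++ _) -catA.
have sxz : val (x * (zb * ze))%g = trace e (Posz 0) :: val zb ++ val ze by [].
rewrite /shift; case: i @m {zbE xE} mze zeE fE eE => n m mze zeE fE eE.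
  have [_ <- _] : [/\ _, _ & _] := trace_approx ff fE (leqnSn n.+1).
  rewrite (_ : Posz n + 1 = Posz n.+1)%R; last by lia.
  have [+ <- _] := trace_approx ee eE (ltnSn n.+1).
  rewrite szx sxz => nz; rewrite catA nth_cat ifT //.
have nm : n < m by rewrite /m /=; lia.
have [_ _ <-] := trace_approx ff fE nm.
rewrite szx catA rev_cat -[rev [:: _]]/[:: _] /=.
case: n @m mze zeE fE eE nm => [//|n] m mze zeE fE eE nm'.
have nm : n < m by exact: ltnW.
have [nz _ nE] := trace_approx ee zeE nm.
rewrite (_ : Negz n.+1 + 1 = Negz n)%R; last by lia.
by rewrite -nE /= rev_cat nth_cat size_rev ifT.
Qed.

(** * Omega powers of words and periodic points *)

Lemma vpi_mul r (u v : word) : vpi r (u * v)%g = (vpi r u * vpi r v)%g.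
Proof. exact: vpiM. Qed.

Lemma idem_power r (w : word) :
  exists k, (vpi r (wpow w k) * vpi r (wpow w k))%g = vpi r (wpow w k).
Proof.
have [S [phi [_ _ _ rE]]] := vrelP r.
have [i [j [ij E]]] : exists i j, i < j /\ phi (wpow w i) = phi (wpow w j).
  apply: contrapT => nij.
  have : injective (fun i : 'I_#|S|.+1 => phi (wpow w i)).
    move=> i j ij; apply: val_inj; apply/eqP; apply: contraT => nE; case: nij.
    have [lt|lt|E] := ltngtP (val i) (val j); last by rewrite E eqxx in nE.
      by exists i, j.
    by exists j, i.
  by move/leq_card; rewrite card_ord ltnn.
have step n c : i <= n -> vpi r (wpow w (n + c * (j - i))) = vpi r (wpow w n).
  move=> lin; elim: c => [|c IHc]; first by rewrite addn0.
  rewrite -IHc; set n' := n + c * (j - i).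
  have ltin' : i <= n' by rewrite (leq_trans lin) ?leq_addr.
  have Eij : vpi r (wpow w i) = vpi r (wpow w j) by apply/vpiP; rewrite rE E.
  have -> : n + c.+1 * (j - i) = n' + (j - i) by rewrite mulSn addnCA addnC.
  have [<-|iltn] := eqVneq i n'; first by rewrite subnKC // ltnW.
  have -> : n' + (j - i) = (j + (n' - i).-1).+1 by lia.
  by rewrite -wpowD vpi_mul -Eij -vpi_mul wpowD; congr (vpi r (wpow w _)); lia.
(* The exponent n+1 is a multiple of the period j-i and at least i+1, where the powers of w have
   become periodic; hence w^(n+1) equals its square. *)
pose n := (i.+1 * (j - i)).-1.
have ltin : i <= n by rewrite /n; nia.
exists n; rewrite -vpi_mul wpowD -[RHS](step n i.+1 ltin).
by congr (vpi r (wpow w _)); rewrite /n; nia.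
Qed.

(** Both equal the power of w with exponent (j+1)(k+1). *)
Lemma idem_power_uniq r (w : word) j k :
  (vpi r (wpow w j) * vpi r (wpow w j))%g = vpi r (wpow w j) ->
  (vpi r (wpow w k) * vpi r (wpow w k))%g = vpi r (wpow w k) ->
  vpi r (wpow w j) = vpi r (wpow w k).
Proof.
have idp (v : word) n :
    (vpi r v * vpi r v)%g = vpi r v -> vpi r (wpow v n) = vpi r v.
  by move=> vv; elim: n => [|n IHn] //=; rewrite vpi_mul IHn.
move=> jj kk; rewrite -(idp _ k jj) -(idp _ j kk) !wpow_wpow.
by congr (vpi r (wpow w _)); lia.
Qed.

Definition om_exp r (w : word) := sval (cid (idem_power r w)).

Lemma om_coherent (w : word) :
  (fun r => vpi r (wpow w (om_exp r w))) \in @coherent V A.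
Proof.
apply/mem_set => r s rs; rewrite vproj_vpi //; apply: idem_power_uniq.
  have := svalP (cid (idem_power r w)); rewrite -/(om_exp r w) -!vpi_mul.
  by move/vpiP/rs/vpiP.
exact: svalP (cid (idem_power s w)).
Qed.

(** The profinite power w^omega: in each finite quotient, the idempotent power of w. *)
Definition om (w : word) : profree :=
  exist (fun z => z \in @coherent V A) _ (om_coherent w).

Lemma om_idem (w : word) : (om w * om w)%g = om w.
Proof.
by apply: profree_eq => r; rewrite pcompM; exact: svalP (cid (idem_power r w)).
Qed.

Lemma om_approx (w : word) r k :
  (vpi r (wpow w k) * vpi r (wpow w k))%g = vpi r (wpow w k) ->
  vpi r (wpow w k) = pcomp (om w) r.
Proof.
by move=> kk; apply: idem_power_uniq kk (svalP (cid (idem_power r w))).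
Qed.

Lemma om_repr (w : word) r : exists k, vpi r (wpow w k) = pcomp (om w) r.
Proof. by exists (om_exp r w). Qed.

Section PeriodicPoint.
Variables (x : biseq A) (p : nat).
Hypothesis xp : iter p.+1 (@shift A) x = x.

Local Notation e := (om (wseg x 0 p)).

Lemma om_repr_wseg r :
  exists k, vpi r (wseg x 0 (k.+1 * p.+1).-1) = pcomp e r.
Proof.
by have [k kE] := om_repr (wseg x 0 p) r; exists k; rewrite -wpow_wseg.
Qed.

Lemma trace_om : trace e = x.
Proof.
have ee := om_idem (wseg x 0 p).
apply: funext => i; pose m := (absz i).+1.
have [k kE] := om_repr_wseg (lcong m).
case: i @m kE => n m kE.
  have [+ <- _] := trace_approx ee kE (ltnSn n).
  by rewrite size_wseg => nk; rewrite nth_wseg ?add0r.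
have nm : n < m by rewrite /m /=; lia.
have [+ _ <-] := trace_approx ee kE nm.
rewrite size_wseg => nk; rewrite nth_rev size_wseg // nth_wseg; last by lia.
rewrite add0r -[RHS](periodicM xp k.+1); congr x.
by move: nk; have : 0 < k.+1 * p.+1 by []; move: (k.+1 * p.+1) => L; lia.
Qed.

Lemma factor_om a (v : word) b : e = (a * % v * b)%g ->
  exists j : nat, v = wseg x (Posz j) (size (val v)).-1.
Proof.
move=> E; have [k kE] := om_repr_wseg (lcong (size (val v))).
have := factor_infix E kE (leqnSn _) => /(infix_wseg a0)[j].
by rewrite add0r; exists j.
Qed.

End PeriodicPoint.

(** Period p+1 of the finite factors of e, tested on length p+2, where it equates the end
    letters. *)
Definition periodic_factors p e := forall a (v : word) b,
  e = (a * % v * b)%g -> size (val v) = p.+2 ->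
  nth a0 (val v) 0 = nth a0 (val v) p.+1.

Lemma periodic_factors_trace p e : (e * e)%g = e -> periodic_factors p e ->
  iter p.+1 (@shift A) (trace e) = trace e.
Proof.
move=> ee ep; apply: funext => i; rewrite iter_shift.
have [a [b E]] := trace_factor i p.+1 ee.
have := ep _ _ _ E (size_wseg _ _ _); rewrite !nth_wseg // => <-.
by rewrite addr0.
Qed.

(** A representative z0^(p+1) starts like the trace, and a sliding window of length p+2 extends the
    agreement to its end. Its length is a multiple of p+1, so it is a power of the first p+1 letters
    of the trace; its class is idempotent, like e. *)
Lemma periodic_factors_om p e : (e * e)%g = e -> periodic_factors p e ->
  e = om (wseg (trace e) 0 p).
Proof.
move=> ee ep; apply: profree_eq => r.
have [z0 [z0r z0l mz]] := idem_approx2 r (lcong p.+1) p.+1 ee.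
have zr := idem_wpow p ee z0r; have zl := idem_wpow p ee z0l.
have zE k : k < size (val (wpow z0 p)) ->
    nth a0 (val (wpow z0 p)) k = trace e (Posz k).
  elim/ltn_ind: k => k IHk kz.
  have [kp|pk] := ltnP k p.+1; first by have [] := trace_approx ee zl kp.
  have sv : size (take p.+2 (drop (k - p.+1) (val (wpow z0 p)))) = p.+2.
    by rewrite size_takel // size_drop; lia.
  have vN : take p.+2 (drop (k - p.+1) (val (wpow z0 p))) != [::].
    by rewrite -size_eq0 sv.
  pose v : word := exist (fun w => w != [::]) _ vN.
  have [a [b E]] : exists a b, e = (a * % v * b)%g.
    apply: (idem_factor ee zl); last by rewrite sv.
    apply/infixP; exists (take (k - p.+1) (val (wpow z0 p))).
    exists (drop p.+2 (drop (k - p.+1) (val (wpow z0 p)))).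
    by rewrite !cat_take_drop.
  have := ep _ _ _ E sv; rewrite !nth_take // !nth_drop addn0 subnK // => <-.
  rewrite IHk; [|lia|lia].
  rewrite -(periodicE (periodic_factors_trace ee ep)); congr (trace e); lia.
have z0E : wpow z0 p = wpow (wseg (trace e) 0 p) (size (val z0)).-1.
  rewrite (wpow_wseg a0) ?periodic_factors_trace // prednK ?size_word //.
  apply: (@eq_wseg _ a0) => [|k kz].
    by rewrite size_wpow; have := size_word z0; nia.
  by rewrite add0r zE // size_wpow; have := size_word z0; nia.
rewrite -zr z0E; apply: om_approx.
by rewrite -z0E zr -[in RHS]ee pcompM.
Qed.

Lemma periodic_factors_conj p e f : (e * e)%g = e -> idem_conj e f ->
  periodic_factors p e -> periodic_factors p f.
Proof.
move=> ee ef ep a v b E; have [c [d cd]] := idem_conj_factor ef.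
apply: (ep (c * a)%g v (b * d)%g).
by rewrite -{1}ee -{1}ee cd E !mulgA.
Qed.

Lemma om_periodic_factors x p :
  iter p.+1 (@shift A) x = x -> periodic_factors p (om (wseg x 0 p)).
Proof.
move=> xp a v b E sv; have [j ->] := factor_om xp E.
by rewrite sv !nth_wseg //= addr0 periodicE.
Qed.

Lemma factor_idem (v : profree) e : (e * e)%g = e -> is_factor v e ->
  exists a b, e = (a * v * b)%g.
Proof.
move=> ee; case=> [E|[a E]|[b E]|//].
- by exists e, e; rewrite -E !ee.
- by exists a, e; rewrite -E ee.
- by exists e, b; rewrite -mulgA -E ee.
Qed.

Lemma mirage_factor X e f a b :
  mirage V X e -> e = (a * f * b)%g -> mirage V X f.
Proof.
move=> Me E w fw; apply: Me; constructor 4; move: E.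
case: fw => [->|[c ->]|[d ->]|[c [d ->]]] ->.
- by exists a, b.
- by exists (a * c)%g, b; rewrite !mulgA.
- by exists a, (d * b)%g; rewrite !mulgA.
- by exists (a * c)%g, (d * b)%g; rewrite !mulgA.
Qed.

(** * Finite conjugacy classes *)

Definition conj_class_size e d := exists h : 'I_d -> profree,
  injective h /\
  forall f, ((f * f)%g = f /\ idem_conj e f) <-> exists i, h i = f.

Lemma conj_class_size_leq e d d' :
  conj_class_size e d -> conj_class_size e d' -> d <= d'.
Proof.
move=> [h [h_inj hP]] [h' [_ hP']].
have /choice[g gP] i : exists i', h' i' = h i.
  by apply/hP'/hP; exists i.
have g_inj : injective g by move=> i j E; apply: h_inj; rewrite -!gP E.
by have := leq_card g g_inj; rewrite !card_ord.
Qed.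

Lemma idem_conj_refl e : (e * e)%g = e -> idem_conj e e.
Proof. by move=> ee; exists e, e; rewrite ee. Qed.

Lemma iter_shift_conj e i : (e * e)%g = e -> exists f,
  [/\ (f * f)%g = f, idem_conj e f & trace f = iter i (@shift A) (trace e)].
Proof.
move=> ee; elim: i => [|i [f [ff ef fi]]].
  by exists e; split=> //; exact: idem_conj_refl.
have [g [gg fg gi]] := shift_conj ff.
by exists g; split; rewrite ?iterS -?fi //; exact: idem_conj_trans fg.
Qed.

(** Here d is the least period of the trace x, and the members are the omega powers read off the d
    shifts of x; their traces tell them apart. Any conjugate f is determined by the first p+1
    letters of its trace, which form a factor of e and so a segment of x. *)
Lemma periodic_conj_class e p : (e * e)%g = e -> periodic_factors p e ->
  exists d, conj_class_size e d /\
    forall n, (d %| n) <-> iter n (@shift A) (trace e) = trace e.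
Proof.
move=> ee ep; set x := trace e; have xp := periodic_factors_trace ee ep.
have ex : exists n, (0 < n) && `[< iter n (@shift A) x = x >].
  by exists p.+1; apply/asboolP.
case: (ex_minnP ex) => d /andP[d_gt0 /asboolP xd] dmin.
have iterM c : iter (c * d) (@shift A) x = x.
  by apply: funext => i; rewrite iter_shift (periodicM xd).
have iter_mod n : iter n (@shift A) x = iter (n %% d) (@shift A) x.
  by rewrite {1}(divn_eq n d) addnC iterD iterM.
have lt_inj i j : i < j < d -> iter i (@shift A) x <> iter j (@shift A) x.
  move=> /andP[ij jd]; rewrite -(subnKC (ltnW ij)) iterD => E.
  have xji : iter (j - i) (@shift A) x = x.
    exact: iter_shift_inj (esym E).
  have : d <= j - i by apply: dmin; rewrite subn_gt0 ij; apply/asboolP.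
  by rewrite leqNgt (leq_ltn_trans (leq_subr _ _) jd).
have period_iter n :
    iter p.+1 (@shift A) (iter n (@shift A) x) = iter n (@shift A) x.
  by rewrite -iterD addnC iterD xp.
exists d; split.
  exists (fun i : 'I_d => om (wseg (iter i (@shift A) x) 0 p)); split.
    move=> i j /(congr1 trace); rewrite !trace_om // => E; apply: val_inj.
    have [lt|lt|//] := ltngtP (val i) (val j).
      by have := lt_inj i j; rewrite lt ltn_ord => /(_ isT).
    by have := lt_inj j i; rewrite lt ltn_ord => /(_ isT) /(_ (esym E)).
  move=> f; split=> [[ff ef]|[i <-]]; last first.
    have [g [gg eg gi]] := iter_shift_conj i ee.
    rewrite -gi -(periodic_factors_om gg) //.
    exact: periodic_factors_conj eg ep.
  have fp := periodic_factors_conj ee ef ep.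
  have [a [b E]] := trace_factor 0 p ff.
  have [c [c' cE]] := idem_conj_factor ef; rewrite !ee in cE.
  have eE : om (wseg x 0 p) = (c * a * % (wseg (trace f) 0 p) * (b * c'))%g.
    by rewrite -periodic_factors_om // [LHS]cE {1}E !mulgA.
  have [j jE] := factor_om xp eE; rewrite size_wseg /= in jE.
  exists (Ordinal (ltn_pmod j d_gt0)); rewrite /= -iter_mod.
  rewrite [RHS](periodic_factors_om ff fp) jE; congr om.
  by apply: val_inj; apply: eq_mkseq => k; rewrite iter_shift add0r addrC.
move=> n; split=> [/dvdnP[c ->]|xn]; first exact: iterM.
apply: contraT => dn; suff : d <= n %% d by rewrite leqNgt ltn_mod d_gt0.
by apply: dmin; rewrite lt0n dn; apply/asboolP; rewrite -iter_mod.
Qed.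

(** The shifts by 0, .., d of the trace of a member are traces of members, so two coincide: this
    trace has a period at most d, dividing d!. By [factor_cut] each factor of e starts the trace of
    a member, and inherits the period d!. *)
Lemma conj_class_periodic e d : (e * e)%g = e -> conj_class_size e d ->
  periodic_factors (d`!).-1 e.
Proof.
move=> ee [h [h_inj hP]].
have conjP f : (f * f)%g = f -> idem_conj e f ->
    iter (d`!) (@shift A) (trace f) = trace f.
  move=> ff ef.
  have /choice[g gP] (i : 'I_d.+1) :
      exists k, trace (h k) = iter i (@shift A) (trace f).
    have [f' [ff' ef' <-]] := iter_shift_conj i ff.
    have /hP[k <-] : (f' * f')%g = f' /\ idem_conj e f'.
      by split=> //; exact: idem_conj_trans ef ef'.
    by exists k.
  have [i [j [ij E]]] : exists i j : 'I_d.+1, i < j /\ g i = g j.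
    apply: contrapT => nij; have : injective g.
      move=> i j ij; apply: val_inj; apply/eqP; apply: contraT => nE; case: nij.
      have [lt|lt|E] := ltngtP (val i) (val j); last by rewrite E eqxx in nE.
        by exists i, j.
      by exists j, i.
    by move/leq_card; rewrite !card_ord ltnn.
  have fij : iter (j - i) (@shift A) (trace f) = trace f.
    by apply: (@iter_shift_inj _ i); rewrite -iterD subnKC ?(ltnW ij) // -!gP E.
  have /dvdnP[c ->] : j - i %| d`!.
    apply: dvdn_fact; rewrite subn_gt0 ij /=.
    by rewrite (leq_trans (leq_subr _ _)) // -ltnS.
  by apply: funext => k; rewrite iter_shift (periodicM fij).
move=> a v b E sv; have [f [ff ef fv]] := factor_cut ee E.
rewrite sv prednK ?fact_gt0 // in fv *.
by rewrite -!fv // -(periodicE (conjP f ff ef)) add0r.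
Qed.

Lemma conj_class_dvd e n : (e * e)%g = e ->
  (exists d, conj_class_size e d /\ d %| n.+1) <->
  iter n.+1 (@shift A) (trace e) = trace e /\ e = om (wseg (trace e) 0 n).
Proof.
move=> ee; split=> [[d [ed dn]]|[xn eE]]; last first.
  have ep : periodic_factors n e by rewrite eE; apply: om_periodic_factors.
  have [d [ed dP]] := periodic_conj_class ee ep.
  by exists d; split=> //; apply/dP.
have ep := conj_class_periodic ee ed.
have [d' [ed' d'P]] := periodic_conj_class ee ep.
have dd' : d = d' by apply/eqP; rewrite eqn_leq !(@conj_class_size_leq e).
rewrite {}dd' in dn; have xn := (d'P _).1 dn; split=> //.
apply: periodic_factors_om => // a v b E sv.
(* The period d! makes every factor of e a segment of the trace, which has period n+1 as well. *)
rewrite (periodic_factors_om ee ep) in E.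
have [j ->] := factor_om (periodic_factors_trace ee ep) E.
by rewrite sv !nth_wseg // addr0 periodicE.
Qed.

End Profree.

(** * From the category to periodic points *)

Section SubshiftLanguage.
Variables (A : finType) (X : set (biseq A)).
Hypothesis hX : is_subshift X.

Lemma subshift_translate x (j : int) : X x ->
  exists y, X y /\ forall k, y k = x (k + j)%R.
Proof.
have [_ _ sX] := hX; move=> Xx; case: j => n.
  exists (iter n (@shift A) x); split; last by move=> k; rewrite iter_shift.
  elim: n => [//|n IHn]; rewrite -sX iterS; exists (iter n (@shift A) x) => //.
(* Each step to the left takes a preimage in X under the shift. *)
elim: n => [|n [y [Xy yE]]].
  move: Xx; rewrite -{1}sX => -[y Xy <-]; exists y; split=> // k.
  by rewrite /shift; congr y; lia.
move: Xy; rewrite -{1}sX => -[z Xz zy]; exists z; split=> // k.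
have := yE (k - 1)%R; rewrite -zy /shift subrK => ->.
by congr x; lia.
Qed.

(** The segment on [-m, m] occurs in a point of X; translated, this point agrees with x there. Such
    points converge to x and X is closed. *)
Lemma language_subshift x : (forall i n, language X (wseg x i n)) -> X x.
Proof.
have [_ clX _] := hX; move=> Lx.
have /choice[y yP] (m : nat) : exists y, X y /\
    forall k, (- m%:Z <= k <= m%:Z)%R -> y k = x k.
  have [y [i [Xy E]]] := Lx (- m%:Z)%R m.*2.
  have [z [Xz zE]] := subshift_translate (i + m%:Z)%R Xy.
  exists z; split=> // k km; rewrite zE.
  have := congr1 (fun s => nth (x 0%R) s (absz (k + m%:Z)%R)) E.
  rewrite nth_wseg; last by lia.
  rewrite size_wseg nth_mkseq; last by lia.
  by move=> F; symmetry; etransitivity; first etransitivity; [|exact: F|];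
    [congr x|congr y]; lia.
apply: (closed_cvg X clX (F := \oo%classic) (u_ := y)).
  by apply: nearW => m; have [] := yP m.
apply/cvg_sup => i; apply/cvg_image => [|B Bx].
  by apply/seteqP; split=> // a _; exists (fun=> a).
exists ((fun f : biseq A => f i) @^-1` B)%classic; last first.
  apply/seteqP; split=> [_ [f Bf <-]//|a Ba]; by exists (fun=> a).
exists (absz i) => // m /= im.
have [_ ->] := yP m; first exact: nbhs_singleton Bx.
by lia.
Qed.

End SubshiftLanguage.

(** * Isomorphism classes of objects *)

Section Isomorphism.
Implicit Types C D : topCategoryData.

Definition obj_iso C (e f : obj C) := exists a b : arr C,
  is_comp a b (ident e) /\ is_comp b a (ident f).

Definition iso_class_size C (e : obj C) d := exists h : 'I_d -> obj C,
  injective h /\ forall f, obj_iso e f <-> exists i, h i = f.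

Lemma top_category_iso_class C D : top_category_iso C D ->
  exists F : obj C -> obj D, bijective F /\
    forall e d, iso_class_size (F e) d <-> iso_class_size e d.
Proof.
case=> F [G [[F' [FK FK' _ _]] [G' [GK GK' _ _]] _ Gi Gcomp]].
have Fiso e f : obj_iso (F e) (F f) <-> obj_iso e f.
  split=> [[a [b [ab ba]]]|[a [b [ab ba]]]].
    by exists (G' a), (G' b); rewrite !Gcomp !GK' !Gi.
  by exists (G a), (G b); rewrite -!Gi -!Gcomp.
exists F; split; first by exists F'.
move=> e d; split=> -[h [h_inj hP]].
  exists (F' \o h); split; first exact: inj_comp (can_inj FK') h_inj.
  move=> f; rewrite -Fiso hP; split=> -[i iE]; exists i.
    by rewrite /= iE FK.
  by rewrite -iE /= FK'.
exists (F \o h); split; first exact: inj_comp (can_inj FK) h_inj.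
move=> f; rewrite -(FK' f) Fiso hP; split=> -[i iE]; exists i.
  by rewrite /= iE.
by apply: (can_inj FK).
Qed.

End Isomorphism.

(** * The category of a mirage *)

Section KMirageCategory.
Variables (V : finSemigroupType -> Prop) (hV : is_pseudovariety V).
Hypothesis hLSl : forall S : finSemigroupType, locally_semilattice S -> V S.
Variables (A : finType) (a0 : A) (X : set (biseq A)).
Hypothesis hX : is_subshift X.

Local Notation K := (K_mirage V X).

Lemma K_objP (e : obj K) : mirage V X (val e) /\ (val e * val e)%g = val e.
Proof. exact: set_mem (valP e). Qed.

Lemma K_obj_iso (e f : obj K) : obj_iso e f <-> idem_conj (val e) (val f).
Proof.
have [Me ee] := K_objP e; have [Mf ff] := K_objP f; split.
  case=> a [b [[_ /= ab] [_ /= ba]]].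
  by exists (val a).1.2, (val b).1.2; case: ab; case: ba.
case=> p [q [epq fqp]].
(* Trimming p and q gives inverse arrows; they stay in the mirage, as factors of e and of f. *)
pose u := (val e * p * val f)%g; pose v := (val f * q * val e)%g.
have absorb (g h r t : profree V A) : (g * g)%g = g -> (h * h)%g = h ->
    g = (r * t)%g -> h = (t * r)%g -> ((g * r * h) * (h * t * g))%g = g.
  move=> gg hh grt htr; rewrite -!mulgA (mulgA h h) hh htr -!mulgA.
  by rewrite (mulgA r t (r * _)%g) -grt (mulgA r t) -grt !gg.
have uv : (u * v)%g = val e by exact: absorb.
have vu : (v * u)%g = val f by exact: absorb.
have uK : (val e, u, val f) \in @K_arr V A X.
  apply/mem_set; split=> //=; last by rewrite /u !mulgA ee -!mulgA ff.
  by apply: (mirage_factor (a := val e) (b := v) Me); rewrite -mulgA uv ee.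
have vK : (val f, v, val e) \in @K_arr V A X.
  apply/mem_set; split=> //=; last by rewrite /v !mulgA ff -!mulgA ee.
  by apply: (mirage_factor (a := val f) (b := u) Mf); rewrite -mulgA vu ff.
exists (exist (fun a => a \in @K_arr V A X) _ uK).
exists (exist (fun a => a \in @K_arr V A X) _ vK).
by split; split; rewrite /= ?uv ?vu //; apply: val_inj.
Qed.

(** Conjugates of e are factors of e, so its conjugacy class in the whole semigroup lies inside the
    category. *)
Lemma idem_conj_mirage e f : (e * e)%g = e -> mirage V X e -> idem_conj e f ->
  mirage V X f.
Proof.
move=> ee Me /idem_conj_factor[a [b E]].
apply: (mirage_factor Me (a := a) (b := b)).
by rewrite -E !ee.
Qed.

Lemma K_iso_class (e : obj K) d :
  iso_class_size e d <-> conj_class_size (val e) d.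
Proof.
have [Me ee] := K_objP e; split=> -[h [h_inj hP]].
  exists (fun i => val (h i)); split; first by move=> i j /val_inj/h_inj.
  move=> f; split=> [[ff ef]|[i <-]].
    have fK : f \in @K_obj V A X.
      by apply/mem_set; split=> //; exact: idem_conj_mirage ef.
    pose f' : obj K := exist (fun f => f \in @K_obj V A X) f fK.
    have /hP[i iE] : obj_iso e f' by apply/K_obj_iso.
    by exists i; rewrite iE.
  by split; [have [] := K_objP (h i)|apply/K_obj_iso/hP; exists i].
have hK i : h i \in @K_obj V A X.
  have [hi ehi] : (h i * h i)%g = h i /\ idem_conj (val e) (h i).
    by apply/hP; exists i.
  by apply/mem_set; split=> //; exact: idem_conj_mirage ehi.
exists (fun i => exist (fun f => f \in @K_obj V A X) _ (hK i)); split.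
  by move=> i j /(congr1 val)/h_inj.
move=> f; rewrite K_obj_iso; have [_ ff] := K_objP f; split=> [ef|[i iE]].
  have [i iE] : exists i, h i = val f by apply/hP.
  by exists i; apply: val_inj.
have /hP[] // : exists i, h i = val f by exists i; rewrite -iE.
Qed.

Definition per_obj n : set (obj K) :=
  [set e | exists d, iso_class_size e d /\ d %| n]%classic.

Lemma om_mirage x p : X x -> iter p.+1 (@shift A) x = x ->
  mirage V X (om V (wseg x 0 p)).
Proof.
move=> Xx xp w /(factor_idem (om_idem V (wseg x 0 p)))[a [b E]].
have [j wE] := factor_om hLSl a0 xp E.
exists x, (Posz j); split=> //; rewrite [in LHS]wE -[LHS]/(mkseq _ _).
by rewrite prednK ?size_word.
Qed.

(** On these objects the trace is injective, each being the omega power of a segment of its trace;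
    [trace_om] gives surjectivity. *)
Lemma per_obj_card n :
  ([set x | X x /\ iter n.+1 (@shift A) x = x]%classic #= per_obj n.+1)%card.
Proof.
pose tr (e : obj K) := trace hLSl a0 (val e).
have dvdP (e : obj K) : per_obj n.+1 e <->
    iter n.+1 (@shift A) (tr e) = tr e /\ val e = om V (wseg (tr e) 0 n).
  have [_ ee] := K_objP e; rewrite -(conj_class_dvd hV) //.
  by split=> -[d [ed dn]]; exists d; split=> //; apply/K_iso_class.
have -> : [set x | X x /\ iter n.+1 (@shift A) x = x]%classic =
    (tr @` per_obj n.+1)%classic.
  apply/seteqP; split=> [x [Xx xn]|_ [e /dvdP[en eE] <-]]; last first.
    have [Me ee] := K_objP e; split=> //.
    by apply: language_subshift => // i k; apply: trace_mirage.
  have eK : om V (wseg x 0 n) \in @K_obj V A X.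
    by apply/mem_set; split; [exact: om_mirage|exact: om_idem].
  have trE := trace_om hLSl a0 xn.
  exists (exist (fun f => f \in @K_obj V A X) _ eK); last exact: trE.
  by apply/dvdP; rewrite /tr /= trE.
apply: inj_card_eq => e f /set_mem/dvdP[_ eE] /set_mem/dvdP[_ fE] tref.
by apply: val_inj; rewrite eE tref -fE.
Qed.

End KMirageCategory.

Lemma card_fset_set_eq (T U : choiceType) (S : set T) (S' : set U) :
  (S #= S')%card -> #|` fset_set S| = #|` fset_set S'|.
Proof.
move=> SS'; have [finS|infS] := pselect (finite_set S).
  by apply/fcard_eq => //; rewrite -(eq_finite_set SS').
have infS' : ~ finite_set S' by rewrite -(eq_finite_set SS').
by rewrite /fset_set; case: pselect => // _; case: pselect.
Qed.

Theorem corollary7p10 (V : finSemigroupType -> Prop)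
    (hV : is_pseudovariety V)
    (hLSl : forall S : finSemigroupType, locally_semilattice S -> V S)
    (A B : finType) (X : set (biseq A)) (Y : set (biseq B))
    (hX : is_subshift X) (hY : is_subshift Y)
    (hiso : top_category_iso (K_mirage V X) (K_mirage V Y)) :
  zeta X = zeta Y.
Proof.
(* A point of each subshift supplies the default letter of its alphabet. *)
have [[x _] _ _] := hX; have [[y _] _ _] := hY.
have [F [[F' FK FK'] FP]] := top_category_iso_class hiso.
have nbXY n : nb_periodic X n.+1 = nb_periodic Y n.+1.
  apply: card_fset_set_eq.
  apply: card_eq_trans (per_obj_card hV hLSl (x 0%R) hX n) _.
  rewrite card_eq_sym.
  apply: card_eq_trans (per_obj_card hV hLSl (y 0%R) hY n) _.
  have -> : per_obj n.+1 = (F @` per_obj n.+1)%classic.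
    apply/seteqP; split=> [e [d [ed dn]]|_ [e [d [ed dn]] <-]]; last first.
      by exists d; split=> //; apply/FP.
    exists (F' e); rewrite ?FK' //; exists d; split=> //.
    by apply/FP; rewrite FK'.
  by apply: inj_card_eq => e f _ _; apply: can_inj FK _ _.
rewrite /zeta; congr fps_exp; apply: funext => -[//|n].
by rewrite nbXY.
Qed.
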